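(* Let $n\ge 1$, $r\ge 2$ and $s\ge 0$ be integers, let $\mathcal{P}=\{P_1,\dots,P_l\}$ be a partition of $[n]$ with $|P_i|\le r$ for all $i$, and let $\mathcal{F}$ be a family of non-empty subsets of $[n]$ such that $s<|F|$ for every $F\in\mathcal{F}$. Then $$\chi(\widetilde{\mathrm{KG}}^r(\mathcal{F},\mathcal{P},s))\ge \left\lceil\frac{\mathrm{ecd}^r(\mathcal{F},\lfloor s/2\rfloor)}{r-1}\right\rceil.$$
   Context: $\widetilde{\mathrm{KG}}^r(\mathcal{F},\mathcal{P},s)$ is the $r$-uniform hypergraph whose vertex set consists of all $A\in\mathcal{F}$ with $\sum_{i=1}^l\max\{|A\cap P_i|-1,0\}\le\lfloor s/2\rfloor$, and whose edges are all $r$-subsets $\{A_1,\dots,A_r\}$ of the vertex set with $|A_i\cap A_j|\le s$ for all $1\le i<j\le r$. $\chi$ denotes the chromatic number (minimum number of colors in a vertex coloring with no monochromatic edge). For $s'\ge0$ and $A,B\subseteq[n]$, write $A\subseteq_{s'}B$ if there is a set $E$ with $|E|\le s'$ and $A\setminus E\subseteq B$. An equitable partition of a set $X$ into $r$ parts is a partition $X=X_1\cup\dots\cup X_r$ (parts possibly empty) with $||X_i|-|X_j||\le1$ for all $i,j$. $\mathrm{ecd}^r(\mathcal{F},s')$ is the minimum size of a set $X_0\subseteq[n]$ such that there is an equitable partition $[n]\setminus X_0=X_1\cup\dots\cup X_r$ with no $F\in\mathcal{F}$ and $i\in\{1,\dots,r\}$ satisfying $F\subseteq_{s'}X_i$.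 *)

(* Defs.v *)
From mathcomp Require Import all_boot.

Set Implicit Arguments.
Unset Strict Implicit.
Unset Printing Implicit Defensive.

Record hypergraph := Hypergraph {
  vertex : finType;
  edges : {set {set vertex}}
}.

Definition proper_coloring (H : hypergraph) (k : nat)
    (c : {ffun vertex H -> 'I_k}) : bool :=
  [forall e in edges H, ~~ [exists i : 'I_k, forall v in e, c v == i]].

Definition colorable (H : hypergraph) (k : nat) : bool :=
  [exists c : {ffun vertex H -> 'I_k}, proper_coloring c].

(* When every edge has at least two vertices, #|vertex H| colors suffice, so
   bounding k by #|vertex H| loses nothing (chromatic_numberP). *)
Definition chromatic_number (H : hypergraph) : nat :=
  \big[minn/#|vertex H|]_(k < #|vertex H|.+1 | colorable H k) k.

(* The truncated predecessor #|A :&: B|.-1 is max (#|A :&: B| - 1) 0. *)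
Definition KGt_vertices (n : nat) (F P : {set {set 'I_n}}) (s : nat) :
    {set {set 'I_n}} :=
  [set A in F | \sum_(B in P) #|A :&: B|.-1 <= s./2].

Definition KGt (n r : nat) (F P : {set {set 'I_n}}) (s : nat) : hypergraph :=
  @Hypergraph {A : {set 'I_n} | A \in KGt_vertices F P s}
    [set e : {set {A : {set 'I_n} | A \in KGt_vertices F P s}} |
      (#|e| == r) &&
      [forall A in e, forall B in e, (A != B) ==> (#|val A :&: val B| <= s)]].

Definition subset_upto (n s' : nat) (A B : {set 'I_n}) : bool :=
  [exists E : {set 'I_n}, (#|E| <= s') && (A :\: E \subset B)].

(* Parts are indexed, since they may be empty and so may coincide. *)
Definition equitable_partition (n r : nat) (X : {ffun 'I_r -> {set 'I_n}})
    (S : {set 'I_n}) : bool :=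
  [&& \bigcup_i X i == S,
      [forall i, forall j, (i != j) ==> [disjoint X i & X j]]
    & [forall i, forall j, #|X i| <= #|X j|.+1]].

Definition ecd_admissible (n r : nat) (F : {set {set 'I_n}}) (s' : nat)
    (X0 : {set 'I_n}) : bool :=
  [exists X : {ffun 'I_r -> {set 'I_n}},
    equitable_partition X (~: X0) &&
    [forall A in F, forall i, ~~ subset_upto s' A (X i)]].

(* The default n is never below an actual value #|X0|; an admissible X0 exists
   as soon as 0 < r and every member of F has more than s' elements (ecdP). *)
Definition ecd (n r : nat) (F : {set {set 'I_n}}) (s' : nat) : nat :=
  \big[minn/n]_(X0 : {set 'I_n} | ecd_admissible r F s' X0) #|X0|.

Lemma bigminnP (I : finType) (p : pred I) (f : I -> nat) (m : nat) (i0 : I) :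
    p i0 -> (forall i, p i -> f i <= m) ->
  (exists2 i, p i & f i = \big[minn/m]_(i | p i) f i) /\
  (forall i, p i -> \big[minn/m]_(i | p i) f i <= f i).
Proof.
move=> p0 fm.
have lb i : p i -> \big[minn/m]_(i | p i) f i <= f i.
  move=> pi; rewrite -big_filter.
  have: i \in [seq i <- index_enum I | p i] by rewrite mem_filter pi mem_index_enum.
  elim: [seq i <- _ | _] => // j t IH; rewrite inE big_cons geq_min.
  by case/predU1P => [<-|/IH ->]; rewrite ?leqnn ?orbT.
split=> //; case: (arg_minnP f p0) => i1 p1 min1; exists i1 => //.
apply/eqP; rewrite eqn_leq lb // andbT.
apply: (big_ind (fun x => f i1 <= x)) => [|x y lex ley|i pi]; [exact: fm | by rewrite leq_min lex ley | exact: min1].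
Qed.

Lemma chromatic_numberP (H : hypergraph) :
    (forall e, e \in edges H -> 1 < #|e|) ->
  colorable H (chromatic_number H) /\
  (forall k, colorable H k -> chromatic_number H <= k).
Proof.
move=> H2.
have colV : colorable H #|vertex H|.
  apply/existsP; exists [ffun v => enum_rank v].
  apply/forall_inP => e /H2 /card_gt1P [u [v [ue ve uv]]].
  apply/existsPn => i; apply/negP => /forall_inP mono.
  case/negP: uv; move: (mono u ue) (mono v ve); rewrite !ffunE.
  by move=> /eqP <- /eqP/enum_rank_inj ->.
have [|[k colk Ek] le_chi] := @bigminnP 'I_(#|vertex H|.+1)
    (fun k => colorable H k) (@nat_of_ord _) #|vertex H| ord_max colV.
  by move=> i _; rewrite -ltnS.
split=> [|j colj]; first by rewrite /chromatic_number -Ek.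
have [ltj|gej] := ltnP j #|vertex H|.+1; first exact: (le_chi (Ordinal ltj)).
exact: leq_trans (le_chi ord_max colV) (ltnW gej).
Qed.

Lemma ecdP (n r : nat) (F : {set {set 'I_n}}) (s' : nat) :
    0 < r -> (forall A, A \in F -> s' < #|A|) ->
  (exists2 X0, ecd_admissible r F s' X0 & #|X0| = ecd r F s') /\
  (forall X0, ecd_admissible r F s' X0 -> ecd r F s' <= #|X0|).
Proof.
move=> r_gt0 ltF; apply: (bigminnP (i0 := setT)) => [|X0 _]; last first.
  by rewrite -[leqRHS]card_ord max_card.
apply/existsP; exists [ffun=> set0]; apply/andP; split.
  rewrite /equitable_partition setCT; apply/and3P; split.
  - by rewrite big1 // => i _; rewrite ffunE.
  - by apply/forallP => i; apply/forallP => j; rewrite !ffunE disjoints_subset sub0set implybT.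
  - by apply/forallP => i; apply/forallP => j; rewrite !ffunE cards0.
apply/forall_inP => A /ltF ltA; apply/forallP => i; rewrite ffunE.
apply/existsPn => E; apply/negP => /andP[leE].
rewrite subset0 setD_eq0 => /subset_leq_card leAE.
by move: ltA; rewrite ltnNge (leq_trans leAE leE).
Qed.

(* Main.v *)
Require Import Defs.
From mathcomp Require Import all_boot all_order all_algebra.
From mathcomp Require Import zify ring.
From Stdlib Require Import FunctionalExtensionality Classical_Prop.

(* For r = p prime, label the non-zero sign vectors x = (X_1, .., X_p) on [n] by pairs
   (rank, sign) with rank monotone in x, sign in Z/p equivariant, and sign constant
   along comparable vectors of equal rank. If no vertex A satisfies A \subset_s' X_i,
   the rank is the largest size of an equitable family of partial transversals of the
   X_i, which is at most n - ecd; otherwise it is determined by the largest color of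
   such an A and by the number of parts i that see this color. No color is seen by all p
   parts, since the sets involved would form a monochromatic edge, so a color accounts
   for p - 1 ranks. There is no such labelling with fewer than n ranks: with
   coefficients in Z/p, a chain-level transfer on the sign vectors pairs to 1 with the
   cochains of the periodic resolution of Z/p pulled back along the signs, while those
   cochains vanish on words with two equal consecutive letters, and every chain of
   length exceeding the number of ranks has these.

   For r = a * b, cut every block into a pieces of size at most b, and let F' consist of
   the sets B whose equitable a-colorability defect exceeds t (a - 1), t being the
   number of colors. The case a provides a monochromatic edge almost inside each vertex
   B of the hypergraph of F' for the refined partition, hence a proper t-coloring of
   that hypergraph; the case b then yields an equitable partition into b sets outside
   F', each of which splits equitably into a parts. *)

Set Implicit Arguments.
Unset Strict Implicit.
Unset Printing Implicit Defensive.

Import Order.TTheory GRing.Theory Num.Theory.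

Local Open Scope ring_scope.

(** * Cochains on words *)

Section Cochains.
Variables (R : comNzRingType) (X : Type).
Implicit Types (f g : seq X -> R) (s : seq X).

(* The augmented simplicial coboundary: f is read as a cochain whose value on a word of
   length k + 1 is its value on an ordered k-simplex, and the empty word is the
   augmentation. *)
Fixpoint cobd f s : R :=
  if s is x :: s' then f s' - cobd (fun w => f (x :: w)) s' else 0.

(* The alternating sum of the f (x_0 .. x_i, j x_i .. j x_k). *)
Fixpoint prism (j : X -> X) f s : R :=
  if s is x :: s' then
    f [:: x, j x & map j s'] - prism j (fun w => f (x :: w)) s'
  else 0.

(** Dual of a chain contraction: the cone with apex [e] over the image under [j], corrected by the
    prism joining the identity to [j]. *)
Definition homotopy (e : X) (j : X -> X) f s : R :=
  f (e :: map j s) - prism j f s.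

Lemma cobdB f g s : cobd (fun w => f w - g w) s = cobd f s - cobd g s.
Proof.
elim: s f g => [|x s IH] f g /=; first by rewrite subr0.
by rewrite IH; ring.
Qed.

Lemma cobd_sum (I : finType) (F : I -> seq X -> R) s :
  cobd (fun w => \sum_i F i w) s = \sum_i cobd (F i) s.
Proof.
elim: s F => [|x s IH] F /=; first by rewrite big1.
by rewrite IH sumrB.
Qed.

Lemma cobd0 s : cobd (fun=> 0) s = 0.
Proof. by elim: s => //= x s ->; rewrite subr0. Qed.

Lemma cobdK f s : cobd (cobd f) s = 0.
Proof.
elim: s f => // x s IH f /=.
by rewrite cobdB IH; ring.
Qed.

Lemma prismB j f g s : prism j (fun w => f w - g w) s = prism j f s - prism j g s.
Proof.
elim: s f g => [|x s IH] f g /=; first by rewrite subr0.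
by rewrite IH; ring.
Qed.

Lemma homotopyB e j f g s :
  homotopy e j (fun w => f w - g w) s = homotopy e j f s - homotopy e j g s.
Proof. by rewrite /homotopy prismB; ring. Qed.

End Cochains.

Lemma cobd_map (R : comNzRingType) (X Y : Type) (h : X -> Y) (f : seq Y -> R) s :
  cobd (fun w => f (map h w)) s = cobd f (map h s).
Proof. by elim: s f => //= x s IH f; rewrite (IH (fun w => f (h x :: w))). Qed.

Section Homotopy.
Variables (R : comNzRingType) (X : Type).
Implicit Types (f g : seq X -> R) (s : seq X).

Lemma prism_homotopy j f s :
  prism j (cobd f) s + cobd (prism j f) s = f (map j s) - f s.
Proof.
elim: s f => [|x s IH] f /=; first by rewrite addr0 subrr.
rewrite prismB cobdB (cobd_map j (fun w => f (x :: j x :: w))).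
have := IH (fun w => f (x :: w)) => /= E.
by rewrite -[f (x :: s)](subKr (f (x :: map j s))) -E; ring.
Qed.

Lemma homotopyP e j f s : homotopy e j (cobd f) s + cobd (homotopy e j f) s = f s.
Proof.
rewrite /homotopy cobdB (cobd_map j (fun w => f (e :: w))) /=.
by rewrite -[RHS](subKr (f (map j s))) -prism_homotopy; ring.
Qed.

(** The two faces that delete one of the equal letters cancel; every other face keeps the
    repetition. *)
Lemma cobd_stutter f :
    (forall s1 a s2, f (s1 ++ [:: a, a & s2]) = 0) ->
  forall s1 a s2, cobd f (s1 ++ [:: a, a & s2]) = 0.
Proof.
move=> f0 s1 a s2; elim: s1 f f0 => [|x s1 IH] f f0 /=; last first.
  by rewrite f0 IH ?subr0 // => s3 b s4; rewrite -[x :: _]/((x :: s3) ++ _) f0.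
rewrite (_ : (fun w => f _) = fun=> 0) ?cobd0; first by ring.
by apply: functional_extensionality => w; rewrite -[_ :: _]/([::] ++ _) f0.
Qed.

End Homotopy.

(** * Norm, difference and transfer for a cyclic action *)

Section CyclicAction.
Variables (q : nat) (X : Type) (act : 'I_q.+2 -> X -> X).
Hypothesis actD : forall a b x, act a (act b x) = act (a + b) x.
Local Notation Zq := 'I_q.+2.
Implicit Types (f g : seq X -> Zq) (s : seq X).

(** The group ring elements N (sum of all group elements) and T - 1, acting on cochains; [tau]
    alternates them, so that consecutive ones compose to zero. *)
Definition tnorm f s : Zq := \sum_a f (map (act a) s).
Definition tdiff f s : Zq := f (map (act 1) s) - f s.
Definition tau (k : nat) := if odd k then tdiff else tnorm.

Lemma map_actD a b s : map (act a) (map (act b) s) = map (act (a + b)) s.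
Proof. by rewrite -map_comp; apply: eq_map => x /=. Qed.

Lemma tauB k f g s : tau k (fun w => f w - g w) s = tau k f s - tau k g s.
Proof.
rewrite /tau; case: odd; first by rewrite /tdiff; ring.
by rewrite /tnorm sumrB.
Qed.

Lemma cobd_tau k f s : cobd (tau k f) s = tau k (cobd f) s.
Proof.
rewrite /tau; case: odd; first by rewrite /tdiff cobdB cobd_map.
by rewrite /tnorm cobd_sum; apply: eq_bigr => a _; rewrite cobd_map.
Qed.

Lemma tnorm_act f a s : tnorm f (map (act a) s) = tnorm f s.
Proof.
rewrite /tnorm [RHS](reindex_inj (addIr a)) /=.
by apply: eq_bigr => b _; rewrite map_actD.
Qed.

Lemma tauK k f s : tau k (tau k.+1 f) s = 0.
Proof.
rewrite /tau /=; case: odd => /=; first by rewrite /tdiff tnorm_act subrr.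
rewrite /tnorm /tdiff sumrB; apply/eqP; rewrite subr_eq0; apply/eqP.
rewrite [RHS](reindex_inj (addrI 1)) /=.
by apply: eq_bigr => a _; rewrite map_actD.
Qed.

(** The empty word is fixed by the action, so its norm is [q.+2] copies of one value, which is zero
    in [Zq]. *)
Lemma tau_nil k f : tau k f [::] = 0.
Proof.
rewrite /tau; case: odd; rewrite ?/tdiff ?subrr //= /tnorm /=.
by rewrite sumr_const card_ord -mulr_natr (@pchar_Zp q.+2) // mulr0.
Qed.


Section Transfer.
Variables (e : nat -> X) (j : nat -> X -> X).

(* The value of f on the k-chain h_k with h_0 = e_0 and h_(k+1) = D_(k+1) (tau_k h_k),
   where D_k is the homotopy contracting to e_k; hence h_(k+1) has boundary tau_k h_k.
   *)
Fixpoint transfer (k : nat) f : Zq :=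
  if k is k'.+1 then transfer k' (tau k' (homotopy (e k) (j k) f))
  else homotopy (e 0%N) (j 0%N) f [::].

Lemma transferB k f g :
  transfer k (fun w => f w - g w) = transfer k f - transfer k g.
Proof.
elim: k f g => [|k IH] f g /=; first by rewrite homotopyB.
rewrite -IH; congr transfer; apply: functional_extensionality => s.
rewrite -tauB; congr tau; apply: functional_extensionality => w.
exact: homotopyB.
Qed.

Lemma transfer0 k : transfer k (fun=> 0) = 0.
Proof.
have <- : (fun w : seq X => (0 : Zq) - 0) = (fun=> 0).
  by apply: functional_extensionality => w; rewrite subrr.
by rewrite transferB subrr.
Qed.

(** Rewriting with [homotopyP] leaves an error term: by induction a transfer of some
    [tau k (tau k.+1 _)], hence zero, and for [k = 0] a norm at the empty word. *)
Lemma transfer_cobd k f : transfer k.+1 (cobd f) = transfer k (tau k f).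
Proof.
elim: k f => [|k IH] f.
  have E h : homotopy (e 0%N) (j 0%N) (cobd h) [::] = h [::].
    by have := homotopyP (e 0%N) (j 0%N) h [::]; rewrite /= addr0.
  rewrite /=.
  have -> : homotopy (e 1%N) (j 1%N) (cobd f) =
            fun s => f s - cobd (homotopy (e 1%N) (j 1%N) f) s.
    by apply: functional_extensionality => s; rewrite -(homotopyP (e 1%N) (j 1%N) f s) addrK.
  have -> : forall g, tau 0 (fun w => f w - cobd g w) =
     fun w => tau 0 f w - cobd (tau 0 g) w.
    by move=> g; apply: functional_extensionality => s; rewrite tauB cobd_tau.
  by rewrite homotopyB E tau_nil subr0.
rewrite [LHS]/=.
have -> : homotopy (e k.+2) (j k.+2) (cobd f) =
            fun s => f s - cobd (homotopy (e k.+2) (j k.+2) f) s.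
  by apply: functional_extensionality => s; rewrite -(homotopyP (e k.+2) (j k.+2) f s) addrK.
have -> : forall g, tau k.+1 (fun w => f w - cobd g w) =
     fun w => tau k.+1 f w - cobd (tau k.+1 g) w.
  by move=> g; apply: functional_extensionality => s; rewrite tauB cobd_tau.
rewrite -[transfer k _]/(transfer k.+1 _) transferB IH.
have -> : tau k (tau k.+1 (homotopy (e k.+2) (j k.+2) f)) = fun=> 0.
  by apply: functional_extensionality => s; exact: tauK.
by rewrite transfer0 subr0.
Qed.

End Transfer.

End CyclicAction.

(** * The periodic resolution as cochains on words of signs *)

Section Resolution.
Variable q : nat.
Local Notation Zq := 'I_q.+2.
Local Notation shift := (fun a g : Zq => a + g).
Local Notation tau := (@tau q Zq shift).
Implicit Types (f : seq Zq -> Zq) (s : seq Zq).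

(* A solution g of tdiff g = f, normalised to vanish on words starting with 0. *)
Definition orbit_sum f s : Zq :=
  let g := head 0 s in
  \sum_(i < g) f (map (shift (i%:R - g)) s).

(** Each orbit of non-empty words has exactly one word starting with 0, so this inverts the norm on
    invariant cochains. *)
Definition restrict0 f s : Zq := if head 0 s == 0 then f s else 0.

(* Cochains of the periodic resolution of Z/q: cobd of the k-th one is tau k.+1 of the
   next. *)
Fixpoint resolution (k : nat) : seq Zq -> Zq :=
  if k is k'.+1 then
    if odd k then orbit_sum (cobd (resolution k'))
    else restrict0 (cobd (resolution k'))
  else fun s => (s == [:: 0])%:R.

Lemma shiftD (a b g : Zq) : shift a (shift b g) = shift (a + b) g.
Proof. exact: addrA. Qed.

(** The sum runs over the translates of [s] that start with 0, .., g - 1, where g is its first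
    letter. A shift by 1 appends the term [f s]; when g + 1 wraps around to 0, the vanishing norm
    supplies it. *)
Lemma tdiff_orbit_sum f s :
    (forall w, tnorm shift f w = 0) -> f [::] = 0 ->
  tdiff shift (orbit_sum f) s = f s.
Proof.
case: s => [|g s] Nf f0; first by rewrite /tdiff subrr f0.
rewrite /tdiff /orbit_sum -[head _ _]/(1 + g) -[head _ _]/g.
set w := g :: s.
have E a : map (shift (a - (1 + g))) (map (shift 1) w) = map (shift (a - g)) w.
  by rewrite -map_comp; apply: eq_map => x /=; ring.
under eq_bigr do rewrite E.
pose h i := f (map (shift (i%:R - g)) w).
have hg : h g = f w.
  rewrite /h natr_Zp subrr; congr f.
  by rewrite -[RHS]map_id; apply: eq_map => x; rewrite add0r.
have [lt|ge] := ltnP g.+1 q.+2.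
  have -> : (1 + g : Zq) = g.+1 :> nat.
    by rewrite /= [(1 %% _)%N]modn_small // add1n modn_small.
  by rewrite big_ord_recr /= -/(h _) hg addrC addrK.
have gE : g = q.+1 :> nat by apply/eqP; rewrite eqn_leq -ltnS ltn_ord.
have -> : (1 + g : Zq) = 0 :> nat.
  by rewrite /= gE [(1 %% _)%N]modn_small // add1n modnn.
rewrite big_ord0 sub0r; apply/eqP; rewrite eq_sym -addr_eq0 -hg addrC.
have := Nf w; rewrite /tnorm (reindex_inj (addIr (- g))) /= => N0.
have {}N0 : \sum_(i < q.+2) h i = 0.
  by rewrite -[RHS]N0; apply: eq_bigr => i _; rewrite /h natr_Zp.
have sumE : \sum_(i < g) h i + h g = \sum_(i < q.+1) h i + h q.+1 by rewrite gE.
by rewrite big_ord_recr /= -sumE in N0; rewrite [X in X == _]N0.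
Qed.

Lemma tnorm_restrict0 f s :
    (forall a w, f (map (shift a) w) = f w) -> f [::] = 0 ->
  tnorm shift (restrict0 f) s = f s.
Proof.
case: s => [|g s] f_inv f0.
  by rewrite f0 /tnorm big1 // => a _; rewrite /restrict0 /= eqxx f0.
rewrite /tnorm (bigD1 (- g)) //= big1 ?addr0 => [|a ne].
  by rewrite /restrict0 /= addNr eqxx -[RHS](f_inv (- g)) /= addNr.
by rewrite /restrict0 /= addr_eq0 (negPf ne).
Qed.

Lemma tnorm_resolution0 s : tnorm shift (resolution 0) s = (size s == 1%N)%:R.
Proof.
case: s => [|g [|h s]] /=; rewrite /tnorm /=; first by rewrite big1.
  2: by rewrite big1 // => a _; rewrite eqseq_cons andbF.
rewrite (bigD1 (- g)) //= addNr eqxx big1 ?addr0 // => a ne.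
by rewrite eqseq_cons eqxx andbT addr_eq0 (negPf ne).
Qed.

Lemma cobd_size1 s : cobd (fun w : seq Zq => (size w == 1%N)%:R : Zq) s = 0.
Proof.
case: s => // g [|h s] /=; first by rewrite subr0.
by rewrite [X in _ - (_ - X)](cobd0 _ s) subr0 subrr.
Qed.

Lemma cobd_resolution k s : cobd (resolution k) s = tau k.+1 (resolution k.+1) s.
Proof.
elim: k s => [|k IH] s; rewrite /tau.
  rewrite /= tdiff_orbit_sum // => w.
  rewrite -[tnorm _ _]/(tau 0 _) -cobd_tau /tau /=.
  rewrite -[RHS](cobd_size1 w); congr cobd.
  by apply: functional_extensionality => v; exact: tnorm_resolution0.
(* [tau k.+1] commutes with [cobd] and turns this resolution cochain into a coboundary by induction;
   so [orbit_sum] or [restrict0] solves the next equation. *)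
have kill w : tau k.+1 (cobd (resolution k.+1)) w = 0.
  rewrite -cobd_tau -[RHS](cobdK (resolution k) w); congr cobd.
  by apply: functional_extensionality => v; rewrite IH.
case: (boolP (odd k)) => [oddk|evenk].
  rewrite /= oddk /= tdiff_orbit_sum // => w.
  by rewrite -[RHS](kill w) /tau /= oddk.
rewrite /= (negPf evenk) /=.
have inv1 w : cobd (resolution k.+1) (map (shift 1) w) = cobd (resolution k.+1) w.
  by apply/eqP; rewrite -subr_eq0 -[X in _ == X](kill w) /tau /= evenk.
have inv a w : cobd (resolution k.+1) (map (shift a) w) = cobd (resolution k.+1) w.
  rewrite -(natr_Zp a); elim: (a : nat) => [|i IHi].
    by congr cobd; rewrite -[RHS]map_id; apply: eq_map => x; rewrite add0r.
  rewrite -[RHS]IHi -[RHS]inv1 (map_actD shiftD); congr cobd.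
  by apply: eq_map => x; rewrite -natr1 [1 + _]addrC.
by have /= := tnorm_restrict0 s inv erefl; rewrite evenk.
Qed.

(** [cobd] preserves vanishing on repetitions, and [orbit_sum] and [restrict0] only evaluate at
    translates of the word, which repeat at the same place. *)
Lemma resolution_stutter k s1 a s2 : resolution k (s1 ++ [:: a, a & s2]) = 0.
Proof.
elim: k s1 a s2 => [|k IH] s1 a s2 /=.
  by case: s1 => [|x [|y s1]] //=; rewrite !eqseq_cons ?andbF.
have C := cobd_stutter IH.
case: odd => /=; first by rewrite /restrict0 C; case: ifP.
by rewrite /orbit_sum big1 // => i _; rewrite map_cat /= C.
Qed.

End Resolution.

(** * A Tucker lemma for monotone labellings of sign vectors *)

Section VanishingHomotopy.
Variables (A : comNzRingType) (X : Type) (R R' : rel X) (e : X) (j : X -> X).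
Hypotheses (RR' : subrel R R') (Rj : forall x y, R x y -> R' (j x) (j y))
  (Rjr : forall x y, R x y -> R' y (j y)).

Lemma prism_eq0 (f : seq X -> A) z s : path R z s ->
    (forall w, size w = (size s).+1 -> path R' z w -> f w = 0) ->
  prism j f s = 0.
Proof.
elim: s z f => //= x s IH z f /andP[zx xs] f0.
have js : path R' (j x) (map j s).
  by rewrite path_map; apply: sub_path xs => a b /Rj.
rewrite f0 /= ?size_map //; last by rewrite (RR' zx) (Rjr zx).
rewrite (IH x) ?subrr // => w sw xw; apply: f0; rewrite /= ?sw //.
by rewrite (RR' zx).
Qed.

Lemma homotopy_eq0 (f : seq X -> A) z s :
    R' z e -> (forall x y, R x y -> R' e (j y)) -> path R z s ->
    (forall w, size w = (size s).+1 -> path R' z w -> f w = 0) ->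
  homotopy e j f s = 0.
Proof.
move=> ze ej zs f0; rewrite /homotopy (prism_eq0 zs f0) subr0 f0 //= ?size_map //.
rewrite ze; case: s zs {f0} => //= x s /andP[zx xs].
by rewrite (ej _ _ zx) path_map; apply: sub_path xs => a b /Rj.
Qed.

End VanishingHomotopy.

(** * Chains of sign vectors and their labellings *)

Section SignVectors.
Variables (T : finType) (q : nat).
Local Notation Zq := 'I_q.+2.
Definition sign_vector := {ffun T -> option Zq}.
Implicit Types (x y : sign_vector) (a b : Zq).

Definition sgact a x : sign_vector := [ffun t => omap (+%R a) (x t)].
Definition supp x : {set T} := [set t | x t != None].
Definition sgle x y := [forall t, (x t == None) || (x t == y t)].

Lemma sgleP x y : reflect (forall t a, x t = Some a -> y t = Some a) (sgle x y).
Proof.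
apply: (iffP forallP) => [xy t a xt|xy t].
  by have /orP[|/eqP <-//] := xy t; rewrite xt.
by case xt: (x t) => [a|] //=; rewrite (xy _ _ xt) eqxx.
Qed.

Lemma sgact0 x : sgact 0 x = x.
Proof. by apply/ffunP => t; rewrite ffunE; case: (x t) => //= a; rewrite add0r. Qed.

Lemma sgactD a b x : sgact a (sgact b x) = sgact (a + b) x.
Proof. by apply/ffunP => t; rewrite !ffunE; case: (x t) => //= c; rewrite addrA. Qed.

Lemma supp_act a x : supp (sgact a x) = supp x.
Proof. by apply/setP => t; rewrite !inE ffunE; case: (x t). Qed.

Lemma sgle_act a x y : sgle x y -> sgle (sgact a x) (sgact a y).
Proof.
move/sgleP => xy; apply/sgleP => t b; rewrite !ffunE.
by case xt: (x t) => [c|] //= <-; rewrite (xy _ _ xt).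
Qed.

Variables (U : {set T}) (t0 : T).
Local Notation u k := (nth t0 (enum U) k).

Definition apex k : sign_vector := [ffun t => if t == u k then Some 0 else None].
Definition add_apex k x : sign_vector := [ffun t => if t == u k then Some 0 else x t].
(** Only [y] has to be non-zero, so a path from [sg0] is a chain of non-zero vectors on the first
    [k] points of [U]. *)
Definition step k x y :=
  [&& sgle x y, supp y != set0 & supp y \subset [set t in take k (enum U)]].
Definition sg0 : sign_vector := [ffun=> None].

Lemma take_subset k : [set t in take k (enum U)] \subset U.
Proof. by apply/subsetP => t; rewrite inE => /mem_take; rewrite mem_enum. Qed.

Lemma nth_take k : (k < #|U|)%N -> u k \in [set t in take k.+1 (enum U)].
Proof.
rewrite cardE => ltk; rewrite inE (take_nth t0) // mem_rcons mem_head //.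
Qed.

Lemma nth_Ntake k : (k < #|U|)%N -> u k \notin [set t in take k (enum U)].
Proof.
rewrite cardE => ltk; have := enum_uniq U; rewrite -{1}(cat_take_drop k (enum U)).
rewrite (drop_nth t0) // cat_uniq => /and3P[_ /norP[/= nin _] _].
by rewrite inE.
Qed.

Lemma takeS k : [set t in take k (enum U)] \subset [set t in take k.+1 (enum U)].
Proof.
apply/subsetP => t; rewrite !inE.
have [ltk|gek] := ltnP k (size (enum U)).
  by rewrite (take_nth t0 ltk) mem_rcons inE => ->; rewrite orbT.
by rewrite !take_oversize // ltnW.
Qed.

Lemma step_supp k x y : step k x y -> (supp y != set0) && (supp y \subset U).
Proof.
by case/and3P => _ -> sub; apply: subset_trans sub (take_subset k).
Qed.

Lemma supp_add_apex k x : supp (add_apex k x) = u k |: supp x.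
Proof. by apply/setP => t; rewrite !inE ffunE; case: (t == _). Qed.

Lemma step_act k a x y : step k x y -> step k (sgact a x) (sgact a y).
Proof. by rewrite /step !supp_act => /and3P[/(sgle_act a) -> -> ->]. Qed.

Lemma path_act k a s : path (step k) sg0 s -> path (step k) sg0 (map (sgact a) s).
Proof.
have E : sgact a sg0 = sg0 by apply/ffunP => t; rewrite !ffunE.
by rewrite -{2}E path_map; apply: sub_path => x y /(step_act a).
Qed.

Lemma step_le k : subrel (step k) (step k.+1).
Proof.
move=> x y /and3P[xy y0 sub]; apply/and3P; split=> //.
exact: subset_trans sub (takeS k).
Qed.

Section Bound.
Variable k : nat.
Hypothesis ltk : (k < #|U|)%N.

Lemma add_apex_supp x y : step k x y ->
  (supp (add_apex k y) != set0) &&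
  (supp (add_apex k y) \subset [set t in take k.+1 (enum U)]).
Proof.
case/and3P=> _ _ sub; rewrite supp_add_apex subUset sub1set nth_take //.
rewrite (subset_trans sub (takeS k)) !andbT.
by apply/set0Pn; exists (u k); rewrite !inE eqxx.
Qed.

Lemma step_add_apex x y : step k x y -> step k.+1 (add_apex k x) (add_apex k y).
Proof.
move=> xy; rewrite /step (add_apex_supp xy) andbT; apply/sgleP => t a.
rewrite !ffunE; case: eqP => // _; case/and3P: xy => /sgleP xy _ _; exact: xy.
Qed.

Lemma step_add_apexr x y : step k x y -> step k.+1 y (add_apex k y).
Proof.
move=> xy; rewrite /step (add_apex_supp xy) andbT; apply/sgleP => t a.
rewrite !ffunE; case: eqP => // -> yt.
have uy : u k \in supp y by rewrite inE yt.
by case/and3P: xy => _ _ /subsetP/(_ _ uy); rewrite (negPf (nth_Ntake ltk)).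
Qed.

Lemma step_apex : step k.+1 sg0 (apex k).
Proof.
have -> : apex k = add_apex k sg0 by apply/ffunP => t; rewrite !ffunE.
rewrite /step supp_add_apex; apply/and3P; split.
- by apply/sgleP => t a; rewrite ffunE.
- by apply/set0Pn; exists (u k); rewrite !inE eqxx.
rewrite subUset sub1set nth_take //=; by apply/subsetP => t; rewrite !inE ffunE.
Qed.

Lemma step_apex_add x y : step k x y -> step k.+1 (apex k) (add_apex k y).
Proof.
move=> xy; rewrite /step (add_apex_supp xy) andbT; apply/sgleP => t a.
by rewrite !ffunE; case: eqP.
Qed.

End Bound.

(** Each stage of [transfer] lengthens the chains by one vector and enlarges their support by one
    point of [U], so only the chains in the hypothesis are ever evaluated. *)
Lemma transfer_eq0 k (f : seq sign_vector -> Zq) : (k < #|U|)%N ->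
    (forall w, size w = k.+1 -> path (step k.+1) sg0 w -> f w = 0) ->
  transfer sgact apex add_apex k f = 0.
Proof.
elim: k f => [|k IH] f ltk f0 /=.
  exact: (homotopy_eq0 (@step_le 0) (step_add_apex ltk) (step_add_apexr ltk)
            (step_apex ltk) (step_apex_add ltk) (s := [::]) isT f0).
apply: IH => [|w sw pw]; first exact: ltnW.
have h0 a : homotopy (apex k.+1) (add_apex k.+1) f (map (sgact a) w) = 0.
  apply: (homotopy_eq0 (@step_le k.+1) (step_add_apex ltk) (step_add_apexr ltk)
            (step_apex ltk) (step_apex_add ltk) (path_act a pw)) => v.
  by rewrite size_map sw; exact: f0.
rewrite /tau; case: odd; last by rewrite /tnorm big1.
rewrite /tdiff h0 -[w in _ - homotopy _ _ _ w]map_id.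
by rewrite -(eq_map sgact0) h0 subrr.
Qed.

Lemma path_step_supp k s :
  path (step k) sg0 s -> all (fun y => (supp y != set0) && (supp y \subset U)) s.
Proof.
elim: s sg0 => //= y s IH z /andP[zy ys].
by rewrite (step_supp zy) (IH _ ys).
Qed.

Variables (m : nat) (rho : sign_vector -> nat) (sigma : sign_vector -> Zq).
Hypotheses
  (rho_bounds : forall x, supp x != set0 -> supp x \subset U -> (0 < rho x <= m)%N)
  (rho_le : forall x y, supp x != set0 -> supp y \subset U -> sgle x y ->
     (rho x <= rho y)%N)
  (sigma_eq : forall x y, supp x != set0 -> supp y \subset U -> sgle x y ->
     rho x = rho y -> sigma x = sigma y)
  (sigma_act : forall a x, supp x != set0 -> supp x \subset U ->
     sigma (sgact a x) = a + sigma x).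

(** Equal consecutive ranks force equal signs by [sigma_eq]; otherwise the rank rises at every
    step. *)
Lemma rho_chain k x s : supp x != set0 -> path (step k) x s ->
  (exists s1 y z s2, x :: s = s1 ++ [:: y, z & s2] /\ sigma y = sigma z) \/
  (rho x + size s <= rho (last x s))%N.
Proof.
elim: s x => [|y s IH] x x0 /=; first by rewrite addn0; right.
case/andP=> xy ys; have /andP[y0 yU] := step_supp xy.
have [le|lt|E] := ltngtP (rho x) (rho y).
- case: (IH y y0 ys) => [[s1 [v [w [s2 [-> E]]]]]|ge]; last by right; lia.
  by left; exists (x :: s1), v, w, s2.
- by have := rho_le x0 yU (proj1 (andP xy)); lia.
left; exists [::], x, y, s; split=> //.
exact: sigma_eq x0 yU (proj1 (andP xy)) E.
Qed.

Let Phi k (s : seq sign_vector) := resolution k (map sigma s).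

(** The value does not depend on [k], by [transfer_cobd] and [cobd_resolution]; for [k = 0] it is
    the norm of [resolution 0] at a single letter. *)
Lemma transfer_resolution k : (k < #|U|)%N ->
  transfer sgact apex add_apex k (tau sgact k (Phi k)) = 1.
Proof.
elim: k => [|k IH] ltk.
  rewrite /= /homotopy subr0 [map _ _]/=.
  rewrite -[RHS](tnorm_resolution0 [:: sigma (apex 0)]).
  rewrite /tau /= /tnorm; apply: eq_bigr => a _; rewrite /Phi.
  have /step_supp/andP[s0 sU] := step_apex ltk.
  by rewrite [map _ _]/= sigma_act.
rewrite -(IH (ltnW ltk)) -[RHS](transfer_cobd sgactD).
(* Equivariance of [sigma] is given for non-zero vectors supported in [U], so the two cochains are
   compared only on chains of these. *)
apply/eqP; rewrite -subr_eq0 -transferB; apply/eqP; apply: transfer_eq0 => // w sw pw.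
have act_map a : map sigma (map (sgact a) w) = map (+%R a) (map sigma w).
  rewrite -!map_comp; apply/eq_in_map => x xw /=.
  by have /allP/(_ _ xw)/andP[s0 sU] := path_step_supp pw; exact: sigma_act.
rewrite /Phi cobd_map cobd_resolution; apply/eqP; rewrite subr_eq0; apply/eqP.
rewrite /tau; case: odd; first by rewrite /tdiff act_map.
by apply: eq_bigr => a _; rewrite act_map.
Qed.

Theorem monotone_tucker : (#|U| <= m)%N.
Proof.
rewrite leqNgt; apply/negP => ltm.
have /eqP := transfer_resolution ltm.
rewrite transfer_eq0 ?(eq_sym 0) ?oner_eq0 // => w sw pw.
(* A chain of [m.+1] vectors cannot have strictly rising ranks between 1 and [m], so two consecutive
   signs agree. *)
have Phi0 v : size v = m.+1 -> path (step m.+1) sg0 v -> Phi m v = 0.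
  case: v => // x s [sz] /= /andP[zx xs]; have /andP[x0 xU] := step_supp zx.
  have [[s1 [y [z [s2 [-> E]]]]]|] := rho_chain x0 xs.
    by rewrite /Phi map_cat /= E resolution_stutter.
  have /path_step_supp ok : path (step m.+1) sg0 (x :: s) by rewrite /= zx.
  have /andP[l0 lU] := allP ok _ (mem_last x s).
  have /andP[_ le_last] := rho_bounds l0 lU.
  have /andP[gt_x _] := rho_bounds x0 xU.
  by rewrite sz => /leq_trans/(_ le_last) ?; exfalso; lia.
have Pa a : Phi m (map (sgact a) w) = 0 by rewrite Phi0 ?size_map //; exact: path_act.
rewrite /tau; case: odd; last by rewrite /tnorm big1.
by rewrite /tdiff Pa Phi0 // subrr.
Qed.

End SignVectors.

Local Close Scope ring_scope.

(** * The case of a prime number of parts *)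

Section EquitableDefect.
Variables (T I : finType).
Implicit Types (F : {set {set T}}) (U : {set T}) (X : I -> {set T}).

Definition equitable_avoiding F s' U X : Prop :=
  [/\ forall i, X i \subset U,
      forall i j, i != j -> [disjoint X i & X j],
      forall i j, #|X i| <= #|X j|.+1
    & forall A i, A \in F -> s' < #|A :\: X i| ].

(* The members of F need not be subsets of U: the reduction from composite r needs sets
   that only almost lie in U. *)
Definition ecd_le F s' U d : bool :=
  [exists X : {ffun I -> {set T}},
    [&& [forall i, X i \subset U],
        [forall i, forall j, (i != j) ==> [disjoint X i & X j]],
        [forall i, forall j, #|X i| <= #|X j|.+1],
        [forall A in F, forall i, s' < #|A :\: X i|]
      & #|U| <= \sum_i #|X i| + d]].

Lemma ecd_leP F s' U d :
  reflect (exists2 X, equitable_avoiding F s' U X & #|U| <= \sum_i #|X i| + d)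
          (ecd_le F s' U d).
Proof.
apply: (iffP existsP) => [[X /and5P[sub dis eqt av le]]|[X [sub dis eqt av] le]].
  exists X => //; split; first exact: forallP.
  - by move=> i j ij; move/forallP/(_ i)/forallP/(_ j)/implyP: dis; apply.
  - by move=> i j; move/forallP/(_ i)/forallP/(_ j): eqt.
  - by move=> A i /(forall_inP av)/forallP.
exists [ffun i => X i]; apply/and5P; split.
- by apply/forallP => i; rewrite ffunE.
- by apply/forallP => i; apply/forallP => j; rewrite !ffunE; apply/implyP/dis.
- by apply/forallP => i; apply/forallP => j; rewrite !ffunE.
- by apply/forall_inP => A FA; apply/forallP => i; rewrite ffunE av.
- by under eq_bigr do rewrite ffunE.
Qed.

(* The partition is encoded by kappa, whose fibres are the blocks: the sum of the max
   (#|A :&: B| - 1) 0 over the blocks B is #|A| - #|kappa @: A|. *)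
Definition almost_transversal (K : finType) (kappa : T -> K) F s' : {set {set T}} :=
  [set A in F | #|A| <= #|kappa @: A| + s'].

Definition no_mono_edge (V : {set {set T}}) s (c : {set T} -> nat) : Prop :=
  forall A : I -> {set T}, (forall i, A i \in V) ->
    (forall i j, i != j -> #|A i :&: A j| <= s) ->
  ~ (forall i j, c (A i) = c (A j)).

End EquitableDefect.

Lemma partial_transversal (T K : finType) (kappa : T -> K) (X : {set T}) n :
  n <= #|kappa @: X| ->
  exists Y : {set T}, [/\ Y \subset X, #|Y| = n & {in Y &, injective kappa}].
Proof.
elim: n => [_|n IH ltn].
  by exists set0; rewrite sub0set cards0; split=> // x y; rewrite inE.
have [Y [YX Yn injY]] := IH (ltnW ltn).
have /subsetPn[_ /imsetP[x xX ->] nY] : ~~ (kappa @: X \subset kappa @: Y).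
  apply/negP => /subset_leq_card; rewrite leqNgt.
  by rewrite (leq_ltn_trans (leq_imset_card _ _)) ?Yn.
have xY : x \notin Y by apply: contra nY; exact: imset_f.
exists (x |: Y); split; first by rewrite subUset sub1set xX.
  by rewrite cardsU1 xY Yn.
move=> y z /setU1P[->|yY] /setU1P[->|zY] //; last exact: injY.
- by move=> E; rewrite E imset_f in nY.
- by move=> E; rewrite -E imset_f in nY.
Qed.

(** [kappa] is injective on [A :&: Y]. Hence a set close to a partial transversal is itself almost
    transversal. *)
Lemma card_transversal (T K : finType) (kappa : T -> K) (A Y : {set T}) :
  {in Y &, injective kappa} -> #|A| <= #|kappa @: A| + #|A :\: Y|.
Proof.
move=> injY; rewrite -(cardsID Y A) leq_add2r -(@card_in_imset _ _ kappa).
  exact/subset_leq_card/imsetS/subsetIl.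
by move=> x y /setIP[_ xY] /setIP[_ yY]; exact: injY.
Qed.

(** A common point of [A] and [B] lies outside [X] or outside [Y]. *)
Lemma card_near_disjoint (T : finType) (A B X Y : {set T}) : [disjoint X & Y] ->
  #|A :&: B| <= #|A :\: X| + #|B :\: Y|.
Proof.
rewrite disjoints_subset => /subsetP XY; apply: leq_trans (leq_card_setU _ _).
apply/subset_leq_card/subsetP => u /setIP[uA uB].
rewrite in_setU !in_setD uA uB !andbT; case uX: (u \in X) => //=.
by have := XY u uX; rewrite in_setC.
Qed.

(** * Equivariant labels of subsets of Z/p *)

Section PrimeBarycentre.
Variable p : nat.
Hypothesis p_pr : prime p.
Implicit Types (S : {set 'F_p}) (a : 'F_p).

Definition barycentre S : 'F_p := ((\sum_(i in S) i) / #|S|%:R)%R.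

Lemma card_shift S S' a : (forall i, ((a + i)%R \in S') = (i \in S)) -> #|S'| = #|S|.
Proof.
move=> SS'; rewrite -(card_imset (mem S) (addrI a)); apply: eq_card => i.
apply/idP/imsetP => [iS'|[k kS ->]]; last by rewrite SS'.
have E : (a + (i - a))%R = i by rewrite addrC subrK.
by exists (i - a)%R; rewrite -?SS' E.
Qed.

(* Primality makes #|S| invertible, so proper non-empty subsets get an equivariant
   label. *)
Lemma barycentre_shift S S' a : S != set0 -> S != setT ->
    (forall i, ((a + i)%R \in S') = (i \in S)) ->
  (barycentre S' = a + barycentre S)%R.
Proof.
move=> S0 ST SS'.
rewrite /barycentre (card_shift SS') (reindex_inj (addrI a)) /=.
under eq_bigl do rewrite SS'.
rewrite big_split /= sumr_const mulrDl -[(a *+ _)%R]mulr_natr mulfK //.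
rewrite -(dvdn_pcharf (pchar_Fp p_pr)); apply/negP => /dvdn_leq.
rewrite card_gt0 S0 leqNgt -[p in _ < p](card_Fp p_pr) => /(_ isT)/negP; apply.
by rewrite -cardsT; apply: proper_card; rewrite properT.
Qed.

End PrimeBarycentre.

(** * Ranks and signs for a prime number of parts *)

Section PrimeCase.
Variables (p : nat) (p_pr : prime p) (T K : finType) (kappa : T -> K).
Variables (U : {set T}) (F : {set {set T}}) (s' s t : nat) (c : {set T} -> nat).
Local Notation V := (almost_transversal kappa F s').
Local Notation sv := (sign_vector T (Zp_trunc (pdiv p))).
Hypotheses (s's : s' + s' <= s)
  (cardU : forall k, #|[set u in U | kappa u == k]| <= p)
  (c_lt : forall A, A \in V -> c A < t)
  (cP : @no_mono_edge T 'F_p V s c).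
Implicit Types (x y : sv) (i j : 'F_p) (A : {set T}).

Definition part x i : {set T} := [set u | x u == Some i].

Lemma part_act a x i : part (sgact a x) (a + i)%R = part x i.
Proof.
apply/setP => u; rewrite !inE ffunE; case: (x u) => //= b.
by rewrite !(inj_eq Some_inj) (inj_eq (addrI a)).
Qed.

Lemma part_le x y i : sgle x y -> part x i \subset part y i.
Proof.
by move/sgleP => xy; apply/subsetP => u; rewrite !inE => /eqP/xy ->.
Qed.

Lemma part_disjoint x i j : i != j -> [disjoint part x i & part x j].
Proof.
move=> ij; rewrite disjoints_subset; apply/subsetP => u; rewrite !inE => /eqP ->.
by rewrite (inj_eq Some_inj).
Qed.

Lemma part_supp x i : part x i \subset supp x.
Proof. by apply/subsetP => u; rewrite !inE => /eqP ->. Qed.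

Lemma suppP x u : u \in supp x -> exists i, u \in part x i.
Proof. by rewrite inE; case E: (x u) => [i|] // _; exists i; rewrite inE E. Qed.

Lemma supp_le x y : sgle x y -> supp x \subset supp y.
Proof.
move=> xy; apply/subsetP => u /suppP[i] /(subsetP (part_le i xy)).
exact: (subsetP (part_supp y i)).
Qed.

Definition hits x i : nat := #|kappa @: part x i|.
Definition min_hits x : nat := hits x [arg min_(i < (0%R : 'F_p)) hits x i].
Definition rich x : {set 'F_p} := [set i | min_hits x < hits x i].
(* The largest size of an equitable family of partial transversals of the parts of x. *)
Definition low_rank x : nat := p * min_hits x + #|rich x|.

(** The signs that [x] takes on the block [k], not values of the coloring [c]. *)
Definition colors_at x (k : K) : {set 'F_p} := [set i | k \in kappa @: part x i].

(* If all parts hit equally many blocks, break the symmetry at some block met by x; a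
   block meeting all p parts has at most p points, so x is fixed on it. *)
Definition low_sign x : 'F_p :=
  if rich x != set0 then barycentre (rich x)
  else if [pick k | k \in kappa @: supp x] is Some k then
    if colors_at x k != setT then barycentre (colors_at x k)
    else odflt 0%R (obind x [pick u in U | kappa u == k])
  else 0%R.

Definition near x i A := #|A :\: part x i| <= s'.
Definition near_sets x : {set {set T}} := [set A in V | [exists i, near x i A]].
Definition top_color x : nat := \max_(A in near_sets x) c A.
Definition top_parts x : {set 'F_p} :=
  [set i | [exists A in V, near x i A && (c A == top_color x)]].

(* Every color takes up p - 1 consecutive ranks, one for each size of top_parts. *)
Definition rank (alpha : nat) x : nat :=
  if near_sets x == set0 then low_rank x
  else alpha + top_color x * p.-1 + #|top_parts x|.
Definition sign x : 'F_p :=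
  if near_sets x == set0 then low_sign x else barycentre (top_parts x).

Lemma hits_act a x i : hits (sgact a x) (a + i)%R = hits x i.
Proof. by rewrite /hits part_act. Qed.

Lemma min_hits_le x i : min_hits x <= hits x i.
Proof. by rewrite /min_hits; case: arg_minnP => // j _; apply. Qed.

Lemma min_hitsP x : exists i, min_hits x = hits x i.
Proof. by eexists. Qed.

Lemma min_hits_act a x : min_hits (sgact a x) = min_hits x.
Proof.
apply/eqP; rewrite eqn_leq; apply/andP; split.
  by have [i ->] := min_hitsP x; rewrite -(hits_act a) min_hits_le.
have [i ->] := min_hitsP (sgact a x).
by rewrite -[i](subrK a) addrC hits_act min_hits_le.
Qed.

Lemma rich_act a x i : ((a + i)%R \in rich (sgact a x)) = (i \in rich x).
Proof. by rewrite !inE min_hits_act hits_act. Qed.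

Lemma rich_neqT x : rich x != setT.
Proof.
have [i E] := min_hitsP x; apply/eqP => /setP/(_ i).
by rewrite !inE E ltnn.
Qed.

Lemma card_ltp (S : {set 'F_p}) : S != setT -> #|S| < p.
Proof.
by rewrite -properT => /proper_card; rewrite cardsT card_Fp.
Qed.

Lemma hits_le x y i : sgle x y -> hits x i <= hits y i.
Proof. by move=> xy; apply/subset_leq_card/imsetS/part_le. Qed.

Lemma min_hits_mono x y : sgle x y -> min_hits x <= min_hits y.
Proof.
move=> xy; have [i ->] := min_hitsP y.
exact: leq_trans (min_hits_le x i) (hits_le i xy).
Qed.

Lemma rich_sub x y : sgle x y -> min_hits x = min_hits y -> rich x \subset rich y.
Proof.
move=> xy E; apply/subsetP => i; rewrite !inE E => /leq_trans; apply.
exact: hits_le.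
Qed.

(** [rich] has fewer than [p] elements, so the rank orders pairs ([min_hits], size of [rich])
    lexicographically. *)
Lemma low_rank_le x y : sgle x y -> low_rank x <= low_rank y.
Proof.
move=> xy; rewrite /low_rank; have := min_hits_mono xy.
rewrite leq_eqVlt => /orP[/eqP E|lt].
  by rewrite E leq_add2l subset_leq_card // rich_sub.
have := card_ltp (rich_neqT x); have := leq_mul (leqnn p) lt; rewrite mulnS; lia.
Qed.

Lemma low_rank_eq x y : sgle x y -> low_rank x = low_rank y ->
  min_hits x = min_hits y /\ rich x = rich y.
Proof.
move=> xy; rewrite /low_rank => E.
have Em : min_hits x = min_hits y.
  apply/eqP; rewrite eqn_leq min_hits_mono //= leqNgt; apply/negP => lt.
  have := card_ltp (rich_neqT x); have := leq_mul (leqnn p) lt; rewrite mulnS; lia.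
split=> //; apply/eqP; rewrite eqEcard rich_sub //=.
by move: E; rewrite Em => /addnI ->.
Qed.

Lemma low_rank_gt0 x : supp x != set0 -> 0 < low_rank x.
Proof.
case/set0Pn => u /suppP[i ui]; rewrite /low_rank.
have ti : 0 < hits x i by rewrite card_gt0; apply/set0Pn; exists (kappa u); exact: imset_f.
have [h0|] := posnP (min_hits x); last by move=> h; rewrite addn_gt0 muln_gt0 h prime_gt0.
by rewrite addn_gt0 card_gt0; apply/orP; right; apply/set0Pn; exists i; rewrite inE h0.
Qed.

Lemma colors_at_act a x k i :
  ((a + i)%R \in colors_at (sgact a x) k) = (i \in colors_at x k).
Proof. by rewrite !inE part_act. Qed.

Lemma colors_at_neq0 x k : k \in kappa @: supp x -> colors_at x k != set0.
Proof.
case/imsetP => u /suppP[i ui] ->; apply/set0Pn; exists i.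
by rewrite inE imset_f.
Qed.

(** With no rich part, every part of [x] and of [y] hits the same number of blocks, so the
    inclusions between the sets of blocks hit are equalities. *)
Lemma colors_at_eq x y k : sgle x y -> low_rank x = low_rank y -> rich x = set0 ->
  colors_at x k = colors_at y k.
Proof.
move=> xy E r0; have [Em Er] := low_rank_eq xy E.
have hE z i : rich z = set0 -> hits z i = min_hits z.
  move/setP/(_ i); rewrite !inE => /negbT; rewrite -leqNgt => le.
  by apply/eqP; rewrite eqn_leq le min_hits_le.
apply/setP => i; rewrite !inE.
suff -> : kappa @: part x i = kappa @: part y i by [].
apply/eqP; rewrite eqEcard imsetS ?part_le //=.
by rewrite -/(hits _ _) -/(hits x i) !hE // -?Er // Em.
Qed.

(** One point of the block from each part makes [p] distinct points, which exhaust the block. *)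
Lemma full_block x k u : supp x \subset U -> colors_at x k = setT ->
  u \in U -> kappa u = k -> u \in supp x.
Proof.
move=> xU full uU uk.
have le : p <= #|[set u in supp x | kappa u == k]|.
  rewrite -[p in p <= _](card_Fp p_pr).
  have ex i : exists u, (u \in part x i) && (kappa u == k).
    have : i \in colors_at x k by rewrite full inE.
    by rewrite inE => /imsetP[v vi ->]; exists v; rewrite vi eqxx.
  have [f fP] := fin_all_exists ex.
  rewrite -(card_codom (f := f)); last first.
    move=> i j E; have := fP i; have := fP j; rewrite E !inE.
    by move=> /andP[/eqP -> _] /andP[/eqP[]].
  apply/subset_leq_card/subsetP => _ /codomP[i ->].
  by have /andP[fi ki] := fP i; rewrite inE ki andbT (subsetP (part_supp x i)).
have sub : [set u in supp x | kappa u == k] \subset [set u in U | kappa u == k].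
  by apply/subsetP => v; rewrite !inE => /andP[v0 ->]; rewrite (subsetP xU) // inE.
have /eqP/setP/(_ u) : [set u in supp x | kappa u == k] == [set u in U | kappa u == k].
  by rewrite eqEcard sub (leq_trans (cardU k)).
by rewrite 2!inE uU uk eqxx andbT => ->.
Qed.

Lemma low_sign_act a x : supp x != set0 -> supp x \subset U ->
  (low_sign (sgact a x) = a + low_sign x)%R.
Proof.
move=> x0 xU; rewrite /low_sign.
have -> : (rich (sgact a x) != set0) = (rich x != set0).
  by rewrite -!card_gt0 (card_shift (rich_act a x)).
case: ifPn => [r0|_].
  exact: (barycentre_shift p_pr r0 (rich_neqT x) (rich_act a x)).
rewrite supp_act; case: pickP => [k kx|k0]; last first.
  by case/set0Pn: x0 => u ux; have := k0 (kappa u); rewrite imset_f.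
have -> : (colors_at (sgact a x) k != setT) = (colors_at x k != setT).
  congr negb; rewrite !eqEcard !subsetT /=.
  by rewrite (card_shift (colors_at_act a x k)).
case: ifPn => [nT|/negPn/eqP full].
  exact: (barycentre_shift p_pr (colors_at_neq0 kx) nT (colors_at_act a x k)).
case: pickP => [u /andP[uU /eqP uk]|none].
  have := full_block xU full uU uk; rewrite inE /= ffunE.
  by case: (x u).
case/imsetP: kx => u ux ku; have := none u.
by rewrite ku eqxx andbT (subsetP xU).
Qed.

Lemma low_sign_eq x y : supp x != set0 -> supp y \subset U -> sgle x y ->
  low_rank x = low_rank y -> low_sign x = low_sign y.
Proof.
move=> x0 yU xy E; have [Em Er] := low_rank_eq xy E; rewrite /low_sign -Er.
case: ifPn => // /negPn/eqP r0.
have memE k : (k \in kappa @: supp y) = (k \in kappa @: supp x).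
  apply/idP/idP => [|]; last exact/subsetP/imsetS/supp_le.
  move/colors_at_neq0; rewrite -(colors_at_eq k xy E r0) => /set0Pn[i].
  by rewrite inE; apply/subsetP/imsetS/part_supp.
rewrite (eq_pick memE); case: pickP => // k kx.
rewrite -(colors_at_eq k xy E r0); case: ifPn => // /negPn/eqP full.
case: pickP => //= u /andP[uU /eqP uk].
have := full_block (subset_trans (supp_le xy) yU) full uU uk; rewrite inE.
by case xu: (x u) => [b|] // _; move/sgleP: xy => /(_ _ _ xu) ->.
Qed.

Lemma near_le x y i A : sgle x y -> near x i A -> near y i A.
Proof.
move=> xy; apply: leq_trans; apply/subset_leq_card/setDS/part_le; exact: xy.
Qed.

Lemma near_act a x i A : near (sgact a x) (a + i)%R A = near x i A.
Proof. by rewrite /near part_act. Qed.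

Lemma near_sets_act a x : near_sets (sgact a x) = near_sets x.
Proof.
apply/setP => A; rewrite !inE; congr andb; apply/existsP/existsP => -[i nA].
  by exists (i - a)%R; rewrite -(near_act a) addrC subrK.
by exists (a + i)%R; rewrite near_act.
Qed.

Lemma near_sets_le x y : sgle x y -> near_sets x \subset near_sets y.
Proof.
move=> xy; apply/subsetP => A; rewrite !inE => /andP[-> /existsP[i nA]].
by apply/existsP; exists i; exact: near_le nA.
Qed.

Lemma top_color_act a x : top_color (sgact a x) = top_color x.
Proof. by rewrite /top_color near_sets_act. Qed.

Lemma top_color_le x y : sgle x y -> top_color x <= top_color y.
Proof.
move=> xy; apply/bigmax_leqP => A /(subsetP (near_sets_le xy)) Ay.
by rewrite [top_color y]/top_color; apply: leq_bigmax_cond.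
Qed.

Lemma top_color_lt x : near_sets x != set0 -> top_color x < t.
Proof.
rewrite -card_gt0 => /(eq_bigmax_cond c)[A Ax]; rewrite -/(top_color x) => ->.
by apply: c_lt; move: Ax; rewrite inE => /andP[].
Qed.

Lemma top_parts_act a x i :
  ((a + i)%R \in top_parts (sgact a x)) = (i \in top_parts x).
Proof.
rewrite !inE top_color_act; apply: eq_existsb => A.
by rewrite near_act.
Qed.

Lemma top_parts_neq0 x : near_sets x != set0 -> top_parts x != set0.
Proof.
rewrite -card_gt0 => /(eq_bigmax_cond c)[A Ax E].
move: Ax; rewrite inE => /andP[AV /existsP[i nA]]; apply/set0Pn; exists i.
by rewrite inE; apply/existsP; exists A; rewrite AV nA /= /top_color E.
Qed.

(** Otherwise choose a vertex of the top color near each part: two of them share at most [s' + s']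
    points, which gives a monochromatic edge. *)
Lemma top_parts_neqT x : top_parts x != setT.
Proof.
apply/eqP => full.
have ex i : exists A, [&& A \in V, near x i A & c A == top_color x].
  have : i \in top_parts x by rewrite full inE.
  by rewrite inE => /existsP.
have [A AP] := fin_all_exists ex.
apply: (cP (A := A)) => [i|i j ij|i j].
- by have /and3P[] := AP i.
- have /and3P[_ ni _] := AP i; have /and3P[_ nj _] := AP j.
  apply: leq_trans (leq_trans (leq_add ni nj) s's).
  exact/card_near_disjoint/part_disjoint.
by have /and3P[_ _ /eqP ->] := AP i; have /and3P[_ _ /eqP ->] := AP j.
Qed.

Lemma top_parts_sub x y : sgle x y -> top_color x = top_color y ->
  top_parts x \subset top_parts y.
Proof.
move=> xy E; apply/subsetP => i; rewrite !inE => /existsP[A /and3P[AV nA cA]].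
by apply/existsP; exists A; rewrite AV (near_le xy nA) -E.
Qed.

(** Take a partial transversal of size [(min_hits x).+1] in each rich part and of size [min_hits x]
    in the others. A member of [F] close to one would be a vertex near a part of [x]. *)
Lemma low_rank_far x : supp x \subset U -> near_sets x = set0 ->
  exists2 X : 'F_p -> {set T}, equitable_avoiding F s' U X & \sum_i #|X i| = low_rank x.
Proof.
move=> xU far.
have ex i : exists Y : {set T},
    [/\ Y \subset part x i, #|Y| = minn (hits x i) (min_hits x).+1
      & {in Y &, injective kappa}].
  by apply: partial_transversal; exact: geq_minl.
have [X XP] := fin_all_exists ex.
have cardX i : #|X i| = min_hits x + (i \in rich x).
  have [_ -> _] := XP i; rewrite inE /minn; have := min_hits_le x i.
  by case: ltnP => ?; case: ltnP => ?; lia.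
exists X; last first.
  under eq_bigr do rewrite cardX.
  rewrite big_split /= sum_nat_const card_Fp // /low_rank -sum1_card; congr addn.
  by rewrite [RHS]big_mkcond; apply: eq_bigr => i _; case: (i \in _).
split=> [i|i j ij|i j|A i FA].
- by have [sub _ _] := XP i; rewrite (subset_trans sub) // (subset_trans (part_supp x i)).
- have [subi _ _] := XP i; have [subj _ _] := XP j.
  exact: disjointW subi subj (part_disjoint x ij).
- by rewrite !cardX -addnS leq_add2l; case: (_ \in _).
rewrite ltnNge; apply/negP => le.
have [sub _ inj] := XP i.
have : A \in near_sets x.
  rewrite !inE FA (leq_trans (card_transversal A inj)) ?leq_add2l //=.
  apply/existsP; exists i; apply: leq_trans le.
  exact/subset_leq_card/setDS.
by rewrite far inE.
Qed.

Lemma ecd_le_prime : (forall A, A \in F -> s' < #|A|) ->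
  @ecd_le T 'F_p F s' U (t * p.-1).
Proof.
move=> cardF; have [le|gt] := leqP #|U| (t * p.-1).
  apply/ecd_leP; exists (fun=> set0); last by rewrite big1 // => i _; rewrite cards0.
  split=> [i|i j _|i j|A i FA]; rewrite ?sub0set ?cards0 ?setD0 ?cardF //.
  by rewrite disjoints_subset sub0set.
apply: contraT => bad.
(* If the claim fails, low ranks are at most [alpha]; with [t * p.-1] ranks for the colors this
   totals [#|U| - 1], one too few for [monotone_tucker]. *)
pose alpha := (#|U| - t * p.-1).-1.
have low_le x : supp x \subset U -> near_sets x = set0 -> low_rank x <= alpha.
  move=> xU /(low_rank_far xU)[X eX <-].
  rewrite leqNgt; apply/negP => lt; case/negP: bad.
  apply/ecd_leP; exists X => //; apply: leq_trans (leq_add lt (leqnn _)).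
  by rewrite /alpha; lia.
exfalso; suff: #|U| <= alpha + t * p.-1 by rewrite /alpha; lia.
have p1 := prime_gt1 p_pr.
have top_le x : near_sets x != set0 -> top_color x * p.-1 + #|top_parts x| <= t * p.-1.
  move=> /top_color_lt lt; have := leq_mul lt (leqnn p.-1).
  have := card_ltp (top_parts_neqT x); rewrite mulSn; lia.
have far_le x y : sgle x y -> near_sets y = set0 -> near_sets x = set0.
  by move=> xy y0; apply/eqP; rewrite -subset0 -y0 near_sets_le.
have parts_gt0 x : near_sets x != set0 -> 0 < #|top_parts x|.
  by move=> /top_parts_neq0; rewrite card_gt0.
have color_step x y : near_sets x != set0 -> top_color x < top_color y ->
    top_color x * p.-1 + #|top_parts x| <= top_color y * p.-1.
  move=> _ lt; have := leq_mul lt (leqnn p.-1).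
  have := card_ltp (top_parts_neqT x); rewrite mulSn; lia.
have [U0|[t0 _]] := set_0Vmem U; first by rewrite U0 cards0.
apply: (@monotone_tucker _ _ U t0 _ (rank alpha) sign)
  => [x x0 xU|x y x0 yU xy|x y x0 yU xy|a x x0 xU].
- rewrite /rank; case: ifPn => [/eqP far|nx].
    by rewrite low_rank_gt0 // (leq_trans (low_le x xU far)) ?leq_addr.
  by rewrite addn_gt0 parts_gt0 // orbT -addnA leq_add2l top_le.
- have xU := subset_trans (supp_le xy) yU; rewrite /rank.
  have [/(far_le x y xy) -> |ny] := eqVneq (near_sets y) set0.
    by rewrite eqxx low_rank_le.
  case: ifPn => [/eqP far|nx]; first by rewrite -addnA (leq_trans (low_le x xU far)) ?leq_addr.
  have := top_color_le xy; rewrite leq_eqVlt => /orP[/eqP E|lt].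
    by rewrite E leq_add2l subset_leq_card // top_parts_sub.
  by rewrite -!addnA leq_add2l (leq_trans (color_step x y nx lt)) ?leq_addr.
- have xU := subset_trans (supp_le xy) yU; rewrite /rank /sign.
  have [/(far_le x y xy) -> |ny] := eqVneq (near_sets y) set0.
    by rewrite eqxx; exact: low_sign_eq.
  (* Equal ranks cannot mix the two cases: low ranks are at most [alpha], the others exceed it. *)
  case: ifPn => [/eqP far|nx] E.
    have := low_le x xU far; have := parts_gt0 y ny.
    by rewrite E; move: (_ * _) => z; lia.
  have Ec : top_color x = top_color y.
    apply/eqP; have := top_color_le xy; rewrite leq_eqVlt => /orP[//|lt].
    have := color_step x y nx lt; have := parts_gt0 y ny.
    by move: E; move: (_ * _) (_ * _) => v w; lia.
  congr barycentre; apply/eqP; rewrite eqEcard top_parts_sub //=.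
  by move: E; rewrite Ec => /addnI ->.
rewrite /sign near_sets_act; case: ifPn => [_|nx]; first exact: low_sign_act.
exact: (barycentre_shift p_pr (top_parts_neq0 nx) (top_parts_neqT x) (top_parts_act a x)).
Qed.

End PrimeCase.

Section Reindex.
Variables (T I J : finType) (f : J -> I).
Hypothesis f_bij : bijective f.

Lemma ecd_le_reindex (F : {set {set T}}) s' U d :
  ecd_le I F s' U d -> ecd_le J F s' U d.
Proof.
case/ecd_leP => X [sub dis eqt av] le; apply/ecd_leP; exists (X \o f).
  split=> [i|i j ij|i j|A i FA] //=; last exact: av.
  by apply: dis; rewrite (inj_eq (bij_inj f_bij)).
by rewrite (reindex f (onW_bij _ f_bij)) in le.
Qed.

Lemma no_mono_edge_reindex (V : {set {set T}}) s c :
  no_mono_edge J V s c -> no_mono_edge I V s c.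
Proof.
move=> cP A AV As Ac; apply: (cP (A \o f)) => [i|i j ij|i j] //=.
by apply: As; rewrite (inj_eq (bij_inj f_bij)).
Qed.

End Reindex.

Lemma eq_card_bijective (I J : finType) : #|I| = #|J| -> exists f : I -> J, bijective f.
Proof.
move=> E; exists (fun i => enum_val (cast_ord E (enum_rank i))).
exists (fun j => enum_val (cast_ord (esym E) (enum_rank j))) => i.
  by rewrite enum_valK cast_ordK enum_rankK.
by rewrite enum_valK cast_ordKV enum_rankK.
Qed.

(** General in [U], [F], [s'] and [s], because the composite step applies it inside a subset with
    the given [s'] and [s], and to another family with both equal to 0. *)
Definition chromatic_bound r : Prop :=
  forall (T K I : finType) (kappa : T -> K) (U : {set T}) (F : {set {set T}})
    (s' s t : nat) (c : {set T} -> nat),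
  #|I| = r -> s' + s' <= s ->
  (forall k, #|[set u in U | kappa u == k]| <= r) ->
  (forall A, A \in F -> s < #|A|) ->
  (forall A, A \in almost_transversal kappa F s' -> c A < t) ->
  no_mono_edge I (almost_transversal kappa F s') s c ->
  ecd_le I F s' U (t * r.-1).

Lemma chromatic_bound_prime p : prime p -> chromatic_bound p.
Proof.
move=> p_pr T K I kappa U F s' s t c cardI s's cardU cardF c_lt cP.
have cardE : #|I| = #|'F_p| by rewrite card_Fp.
have [f f_bij] := eq_card_bijective cardE; have [g g_bij] := eq_card_bijective (esym cardE).
apply: (ecd_le_reindex f_bij); apply: (@ecd_le_prime p _ _ _ kappa U F s' s t c) => //.
- exact: no_mono_edge_reindex f_bij _ _ _ cP.
- by move=> A /cardF; apply: leq_ltn_trans; lia.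
Qed.

Section Trim.
Variables (T I : finType) (F : {set {set T}}) (s' : nat) (U : {set T}).

(** Removing a point from a largest part keeps the sizes equitable, and shrinking parts preserves
    avoidance. *)
Lemma equitable_trim (X : I -> {set T}) M :
    equitable_avoiding F s' U X -> M <= \sum_i #|X i| ->
  exists2 Z : I -> {set T}, equitable_avoiding F s' U Z & \sum_i #|Z i| = M.
Proof.
move=> eX /subnK; move: (_ - M) => n.
elim: n X eX => [|n IH] X eX E; first by exists X.
have [i i_gt0] : exists i, 0 < #|X i|.
  apply/existsP; apply: contraT => /existsPn none.
  suff : \sum_i #|X i| = 0 by rewrite -E.
  by apply: big1 => i _; apply/eqP; rewrite -leqn0 leqNgt.
pose j := [arg max_(j > i) #|X j|].
have j_max k : #|X k| <= #|X j| by rewrite /j; case: arg_maxnP => // m _; apply.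
have /card_gt0P[u uj] := leq_trans i_gt0 (j_max i).
pose Z k := if k == j then X j :\ u else X k.
have ZX k : Z k \subset X k by rewrite /Z; case: eqP => // ->; exact: subD1set.
have cardZ k : #|X k| = (k == j) + #|Z k|.
  by rewrite /Z; case: eqP => // ->; rewrite (cardsD1 u) uj.
case: eX => sub dis eqt av; apply: (IH Z).
  split=> [k|k l kl|k l|A k FA].
  - exact: subset_trans (ZX k) (sub k).
  - exact: disjointW (ZX k) (ZX l) (dis k l kl).
  - have := eqt k l; have := j_max k; rewrite !cardZ eqxx.
    by case: eqP => [->|_]; case: eqP => [->|_]; lia.
  - by apply: leq_trans (av A k FA) _; apply/subset_leq_card/setDS.
apply: succn_inj; rewrite -addSn E; under eq_bigr do rewrite cardZ.
by rewrite big_split /= (bigD1 j) //= eqxx big1 // => k /negPf ->.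
Qed.

End Trim.

(** Each value differs from the average by less than one; the term at [j] makes both inequalities
    strict. *)
Lemma equitable_average (I : finType) (f : I -> nat) (j : I) :
    (forall i k, f i <= (f k).+1) ->
  #|I| * f j < \sum_i f i + #|I| /\ \sum_i f i < #|I| * (f j).+1.
Proof.
move=> eqt; rewrite -!sum_nat_const -[#|I|]sum1_card -big_split /=.
by split; rewrite [X in X < _](bigD1 j) // [X in _ < X](bigD1 j) //= -addSn;
   rewrite leq_add ?addn1 // leq_sum // => i _; rewrite ?addn1.
Qed.

(** * Composite numbers of parts *)

Section Composite.
Variables (a b : nat) (a_gt0 : 0 < a) (b_gt0 : 0 < b).

Section SplitBlocks.
Variables (T K : finType) (kappa : T -> K) (U : {set T}).
Hypothesis cardU : forall k, #|[set u in U | kappa u == k]| <= a * b.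

Definition rank_in_block u := index u (enum [set v in U | kappa v == kappa u]).
(* Cuts each block, in its enumeration order, into runs of length b. *)
Definition split_block u : K * 'I_#|T|.+1 := (kappa u, inord (rank_in_block u %/ b)).

Lemma rank_in_block_lt u : u \in U -> rank_in_block u < a * b.
Proof.
move=> uU; apply: leq_trans (cardU (kappa u)).
by rewrite cardE index_mem mem_enum inE uU eqxx.
Qed.

Lemma rank_in_block_inj u v : u \in U -> v \in U -> kappa u = kappa v ->
  rank_in_block u = rank_in_block v -> u = v.
Proof.
move=> uU vU E; rewrite /rank_in_block E => Ei.
rewrite -[LHS](@nth_index _ u u (enum [set w in U | kappa w == kappa v])).
  by rewrite Ei nth_index // mem_enum inE vU eqxx.
by rewrite mem_enum inE uU E eqxx.
Qed.

Lemma split_blockE u : u \in U -> (split_block u).2 = rank_in_block u %/ b :> nat.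
Proof.
move=> uU; rewrite inordK // ltnS (leq_trans (leq_div _ _)) //.
by apply: leq_trans (index_size _ _) _; rewrite -cardE max_card.
Qed.

(** Within a piece the quotient by [b] is fixed, so the remainder determines the point. *)
Lemma card_split_block km : #|[set u in U | split_block u == km]| <= b.
Proof.
rewrite -[b in _ <= b]card_ord.
pose f u := Ordinal (ltn_pmod (rank_in_block u) b_gt0).
rewrite -(card_in_imset (f := f)) ?max_card //.
move=> u v; rewrite !inE => /andP[uU /eqP Eu] /andP[vU /eqP Ev] [Em].
have Es : split_block u = split_block v by rewrite Eu Ev.
apply: rank_in_block_inj => //; first by case: Es.
rewrite (divn_eq (rank_in_block u) b) (divn_eq (rank_in_block v) b) Em.
by rewrite -!split_blockE // Es.
Qed.

(** Ranks below [a * b] give at most [a] pieces per block, and [B] has at most one point in each. *)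
Lemma card_block_split_transversal (B : {set T}) k : B \subset U ->
  #|B| <= #|split_block @: B| -> #|[set u in B | kappa u == k]| <= a.
Proof.
move=> /subsetP BU leB.
have /imset_injP inj : #|split_block @: B| == #|B| by rewrite eqn_leq leq_imset_card.
rewrite -[a in _ <= a]card_ord.
pose f u : 'I_a := insubd (Ordinal a_gt0) (rank_in_block u %/ b).
have fE u : u \in U -> f u = rank_in_block u %/ b :> nat.
  by move=> uU; rewrite /f val_insubd ltn_divLR // rank_in_block_lt.
rewrite -(card_in_imset (f := f)) ?max_card // => u v.
rewrite !inE => /andP[uB /eqP Eu] /andP[vB /eqP Ev] Ef; apply: inj => //.
have E2 : (split_block u).2 = (split_block v).2.
  by apply: ord_inj; rewrite !split_blockE ?BU // -!fE ?BU ?Ef.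
by congr pair; [rewrite Eu Ev | exact: E2].
Qed.

End SplitBlocks.

Lemma chromatic_bound_mul :
  chromatic_bound a -> chromatic_bound b -> chromatic_bound (a * b).
Proof.
move=> Ha Hb T K I kappa U F s' s t c cardI s's cardU cardF c_lt cP.
have cardE : #|I| = #|{: 'I_b * 'I_a}| by rewrite card_prod !card_ord mulnC.
have [f f_bij] := eq_card_bijective cardE.
have {}cP := no_mono_edge_reindex f_bij cP; apply: (ecd_le_reindex f_bij).
pose V := almost_transversal kappa F s'.
(* A member B of F' that is transversal to the split blocks meets every block in at most
   a points, so Ha yields a monochromatic edge of sets almost inside B; color B by its
   color. *)
pose F' : {set {set T}} := [set B : {set T} | (B \subset U) && ~~ ecd_le 'I_a F s' B (t * a.-1)].
pose V' := almost_transversal (split_block kappa U) F' 0.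
have F'_gt0 B : B \in F' -> 0 < #|B|.
  rewrite inE lt0n => /andP[_]; apply: contra; rewrite cards_eq0 => /eqP ->.
  apply/ecd_leP; exists (fun=> set0); last by rewrite cards0.
  split=> [i|i j _|i j|A i FA]; rewrite ?sub0set ?cards0 ?setD0 //.
    by rewrite disjoints_subset sub0set.
  by apply: leq_ltn_trans (cardF A FA); lia.
have inner B : exists k, B \in V' -> k < t /\ exists A : 'I_a -> {set T},
    [/\ forall i, A i \in V, forall i, #|A i :\: B| <= s',
        forall i j, i != j -> #|A i :&: A j| <= s & forall i, c (A i) = k].
  case: (boolP (B \in V')) => [BV'|_]; last by exists 0.
  apply: NNPP => none; move: BV'; rewrite 2!inE addn0 => /andP[/andP[BU bad] leB].
  apply: (negP bad).
  (* Members of [F] outside [FB] miss every subset of [B] by more than [s'] points, so avoiding [FB]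
     inside [B] is avoiding [F]. *)
  pose FB := [set A in F | #|A :\: B| <= s'].
  have FBV A : A \in almost_transversal kappa FB s' -> A \in V /\ #|A :\: B| <= s'.
    by rewrite !inE => /andP[/andP[-> ->] ->].
  have : ecd_le 'I_a FB s' B (t * a.-1).
    apply: (Ha _ _ _ kappa B FB s' s t c) => //; first exact: card_ord.
    - by move=> k; exact: card_block_split_transversal cardU _ _ BU leB.
    - by move=> A; rewrite inE => /andP[/cardF].
    - by move=> A /FBV[/c_lt].
    move=> A AV As Ac; apply: none.
    exists (c (A (Ordinal a_gt0))) => _; split.
      by have /FBV[/c_lt] := AV (Ordinal a_gt0).
    by exists A; split=> // i; have /FBV[] := AV i.
  case/ecd_leP => X [sub dis eqt av] le; apply/ecd_leP; exists X => //; split=> // A i FA.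
  rewrite ltnNge; apply/negP => near.
  have := av A i; rewrite inE FA ltnNge near /= => H; apply: notF; apply: H.
  by apply: leq_trans near; apply/subset_leq_card/setDS.
have [c' c'P] := fin_all_exists inner.
have : ecd_le 'I_b F' 0 U (t * b.-1).
  apply: (Hb _ _ _ (split_block kappa U) U F' 0 0 t c') => //; first exact: card_ord.
  - exact: card_split_block.
  - by move=> B /c'P[].
  move=> B BV Bs Bc.
  have exA i := (c'P (B i) (BV i)).2.
  have [A AP] := fin_all_exists exA.
  (* Sets from the same [B i] meet in at most [s] points by choice; sets from different ones do
     because the [B i] are disjoint. *)
  apply: (cP (fun ij => A ij.1 ij.2)) => [[i j]|[i j] [i' j']|[i j] [i' j']] /=.
  - by have [] := AP i.
  - case: (eqVneq i i') => [<-|ii'] ne.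
      have [_ _ + _] := AP i; apply; by apply: contraNneq ne => ->.
    have [_ ni _ _] := AP i; have [_ ni' _ _] := AP i'.
    apply: leq_trans (leq_trans (leq_add (ni j) (ni' j')) s's).
    by apply: card_near_disjoint; rewrite -setI_eq0 -cards_eq0 -leqn0 Bs.
  by have [_ _ _ ->] := AP i; have [_ _ _ ->] := AP i'; exact: Bc.
case/ecd_leP => X [sub dis eqt av] le.
(* [X i] contains itself, so it is not in [F'] and splits into [a] parts. Trimming to an exact total
   makes the totals for different [i] differ by at most one. *)
have exZ i : exists Z : 'I_a -> {set T},
    equitable_avoiding F s' (X i) Z /\ \sum_j #|Z j| = #|X i| - t * a.-1.
  have : ecd_le 'I_a F s' (X i) (t * a.-1).
    apply: contraT => bad; have := av (X i) i; rewrite inE sub bad setDv cards0.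
    by move/(_ isT).
  case/ecd_leP => Y eY leY.
  have [|Z eZ sZ] := equitable_trim (M := #|X i| - t * a.-1) eY; first by rewrite leq_subLR addnC.
  by exists Z.
have [Z ZP] := fin_all_exists exZ.
apply/ecd_leP; exists (fun ij => Z ij.1 ij.2).
  split=> [[i j]|[i j] [i' j']|[i j] [i' j']|A [i j] FA] /=.
  - by have [[sZ _ _ _] _] := ZP i; exact: subset_trans (sZ j) (sub i).
  - have [[sZ dZ _ _] _] := ZP i; have [[sZ' _ _ _] _] := ZP i'.
    case: (eqVneq i i') => [<-|ii'] ne; last exact: disjointW (sZ j) (sZ' j') (dis i i' ii').
    by apply: dZ; apply: contraNneq ne => ->.
  - have [[_ _ eZ _] sumZ] := ZP i; have [[_ _ eZ' _] sumZ'] := ZP i'.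
    (* Part sizes two apart would force totals at least two apart. *)
    have [lo _] := equitable_average j eZ; have [_ hi] := equitable_average j' eZ'.
    rewrite sumZ card_ord in lo; rewrite sumZ' card_ord in hi.
    rewrite leqNgt; apply/negP => lt.
    have := leq_mul (leqnn a) lt; have := eqt i i'; rewrite !mulnS in hi *; lia.
  - by have [[_ _ _ aZ] _] := ZP i; exact: aZ.
have -> : \sum_(ij : 'I_b * 'I_a) #|Z ij.1 ij.2| = \sum_i (#|X i| - t * a.-1).
  rewrite -(pair_bigA _ (fun i j => #|Z i j|)) /=.
  by apply: eq_bigr => i _; have [_ ->] := ZP i.
apply: leq_trans le _.
have : \sum_i #|X i| <= \sum_i (#|X i| - t * a.-1) + b * (t * a.-1).
  have -> : b * (t * a.-1) = \sum_(i < b) t * a.-1 by rewrite sum_nat_const card_ord.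
  by rewrite -big_split /=; apply: leq_sum => i _; rewrite addnC -leq_subLR.
have -> : t * (a * b).-1 = t * b.-1 + b * (t * a.-1).
  by case: a a_gt0 b b_gt0 => // a' _ [] // b' _; rewrite /=; nia.
lia.
Qed.

End Composite.

Lemma chromatic_bound_gt1 r : 1 < r -> chromatic_bound r.
Proof.
have [n] := ubnP r; elim: n r => // n IH r; rewrite ltnS => le_rn r_gt1.
have [|npr] := boolP (prime r); first exact: chromatic_bound_prime.
have p_pr := pdiv_prime r_gt1; have r_gt0 := ltnW r_gt1.
have rE := divnK (pdiv_dvd r).
have lt_pr : pdiv r < r.
  rewrite ltn_neqAle pdiv_leq // andbT; apply: contra npr => /eqP <-; exact: p_pr.
have d_gt1 : 1 < r %/ pdiv r.
  by rewrite -(ltn_pmul2r (prime_gt0 p_pr)) rE mul1n.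
rewrite -rE; apply: chromatic_bound_mul; first exact: ltnW.
- exact: prime_gt0.
- apply: IH => //; apply: leq_trans le_rn; exact: ltn_Pdiv (prime_gt1 p_pr) r_gt0.
- exact: chromatic_bound_prime.
Qed.

(** * Back to the hypergraph *)

(** Each block met by [A] accounts for one element of the image, which restores the 1 subtracted
    from its term. *)
Lemma sum_excess_partition (T : finType) (P : {set {set T}}) (A : {set T}) :
  partition P [set: T] -> \sum_(B in P) #|A :&: B|.-1 + #|pblock P @: A| = #|A|.
Proof.
move=> partP; have tiP := partition_trivIset partP.
have coverP u : u \in cover P by rewrite (cover_partition partP) inE.
have blockP B : B \in pblock P @: A -> B \in P.
  by case/imsetP => u _ ->; exact: pblock_mem.
have fibre B : B \in P -> #|A :&: B| = \sum_(u in A | pblock P u == B) 1.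
  move=> PB; rewrite -sum1_card; apply: eq_bigl => u; rewrite inE; congr andb.
  apply/idP/eqP => [uB|<-]; first exact: def_pblock.
  by rewrite mem_pblock.
have -> : \sum_(B in P) #|A :&: B|.-1 = \sum_(B in pblock P @: A) #|A :&: B|.-1.
  rewrite (bigID (mem (pblock P @: A))) /= addnC big1 => [|B /andP[PB nB]].
    by apply: eq_bigl => B; rewrite andb_idl //; exact: blockP.
  rewrite (_ : A :&: B = set0) ?cards0 //; apply/setP => u; rewrite !inE.
  apply: contraNF nB => /andP[uA uB]; apply/imsetP; exists u => //.
  exact/esym/def_pblock.
rewrite -[#|pblock P @: A|]sum1_card -big_split /=.
rewrite -[RHS]sum1_card (partition_big_imset (pblock P)) /=.
apply: eq_bigr => B imB; rewrite -fibre ?blockP // addn1 prednK //.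
case/imsetP: imB => u uA ->; apply/card_gt0P; exists u.
by rewrite inE uA mem_pblock coverP.
Qed.

Lemma ecd_le_ecd n r (F : {set {set 'I_n}}) s' d : 0 < r ->
    (forall A, A \in F -> s' < #|A|) ->
  ecd_le 'I_r F s' setT d -> ecd r F s' <= d.
Proof.
move=> r_gt0 cardF /ecd_leP[X [_ dis eqt av]]; rewrite cardsT => le.
have [_ min] := ecdP r_gt0 cardF.
(* The deleted set consists of the points outside all parts. *)
have /min/leq_trans : ecd_admissible r F s' (~: \bigcup_i X i).
  apply/existsP; exists [ffun i => X i]; apply/andP; split.
    apply/and3P; split.
    - by rewrite setCK; apply/eqP/eq_bigr => i _; rewrite ffunE.
    - by apply/forallP => i; apply/forallP => j; rewrite !ffunE; apply/implyP/dis.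
    - by apply/forallP => i; apply/forallP => j; rewrite !ffunE.
  apply/forall_inP => A FA; apply/forallP => i; rewrite ffunE.
  apply/existsPn => E; apply/negP => /andP[leE sub].
  have := leq_trans (av A i FA) (leq_trans _ leE).
  rewrite ltnn => H; apply: notF; apply: H; apply/subset_leq_card.
  by rewrite subDset setUC -subDset.
apply; rewrite cardsCs setCK leq_subLR; apply: leq_trans le _.
rewrite leq_add2r -sum1_card partition_disjoint_bigcup //.
by apply: leq_sum => i _; rewrite sum1_card.
Qed.

Lemma KGt_vertices_almost_transversal n (F P : {set {set 'I_n}}) s :
  partition P [set: 'I_n] ->
  KGt_vertices F P s = almost_transversal (pblock P) F s./2.
Proof.
move=> partP; apply/setP => A; rewrite !inE; congr andb.
by rewrite -(sum_excess_partition A partP) addnC leq_add2l.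
Qed.

Lemma proper_coloring_no_mono_edge n r s k (F P : {set {set 'I_n}})
    (c : {ffun vertex (KGt r F P s) -> 'I_k}) :
    0 < r -> (forall A, A \in F -> s < #|A|) -> proper_coloring c ->
  exists2 f : {set 'I_n} -> nat, forall A, A \in KGt_vertices F P s -> f A < k
    & no_mono_edge 'I_r (KGt_vertices F P s) s f.
Proof.
move=> r_gt0 cardF /forall_inP c_proper.
pose vtx A : option {A : {set 'I_n} | A \in KGt_vertices F P s} := insub A.
exists (fun A => if vtx A is Some v then val (c v) else 0) => [A AV|A AV As Ac].
  by rewrite /vtx insubT /=.
pose v i : {A : {set 'I_n} | A \in KGt_vertices F P s} := Sub (A i) (AV i).
(* Equal sets would meet in more than [s] points, so the family really has [r] distinct members. *)
have A_inj i j : A i = A j -> i = j.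
  move=> E; apply: contraTeq isT => /As; rewrite E setIid leqNgt cardF //.
  by have := AV j; rewrite inE => /andP[].
have v_inj : injective v by move=> i j /(congr1 val)/A_inj.
have edge : [set v i | i : 'I_r] \in edges (KGt r F P s).
  rewrite inE card_imset // card_ord eqxx /=.
  apply/forall_inP => _ /imsetP[i _ ->]; apply/forall_inP => _ /imsetP[j _ ->].
  by apply/implyP; rewrite (inj_eq v_inj) => /As.
case/negP: (c_proper _ edge); apply/existsP; exists (c (v (Ordinal r_gt0))).
apply/forall_inP => _ /imsetP[i _ ->]; apply/eqP/val_inj.
have vE j : vtx (A j) = Some (v j) by exact: insubT.
by have := Ac i (Ordinal r_gt0); rewrite !vE.
Qed.

Theorem theorem4 (n r s : nat) (P F : {set {set 'I_n}})
    (n_ge1 : 1 <= n) (r_ge2 : 2 <= r)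
    (partP : partition P [set: 'I_n])
    (cardP : forall B : {set 'I_n}, B \in P -> #|B| <= r)
    (F_nonempty : forall A : {set 'I_n}, A \in F -> A != set0)
    (cardF : forall A : {set 'I_n}, A \in F -> s < #|A|) :
  (Num.ceil ((ecd r F s./2)%:R / (r - 1)%N%:R : rat)
     <= (chromatic_number (KGt r F P s))%:Z)%R.
Proof.
have r_gt0 := ltnW r_ge2.
have half_le : s./2 + s./2 <= s by rewrite addnn -{2}(odd_double_half s) leq_addl.
have half_lt A : A \in F -> s./2 < #|A| by move/cardF; apply: leq_ltn_trans; lia.
have edge_gt1 e : e \in edges (KGt r F P s) -> 1 < #|e| by rewrite inE => /andP[/eqP ->].
have [colH _] := chromatic_numberP edge_gt1.
case/existsP: colH => c /(proper_coloring_no_mono_edge r_gt0 cardF).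
rewrite KGt_vertices_almost_transversal // => -[f f_lt fP].
have bound : ecd r F s./2 <= chromatic_number (KGt r F P s) * r.-1.
  apply: ecd_le_ecd => //.
  apply: (chromatic_bound_gt1 r_ge2 (kappa := pblock P)) fP => //.
    exact: card_ord.
  (* The fibre of [pblock P] over a block is contained in that block; over any other set it is
     empty. *)
  move=> B; case: (boolP (B \in P)) => [PB|nB].
    apply: leq_trans (cardP B PB); apply/subset_leq_card/subsetP => u.
    rewrite !inE => /andP[_ /eqP <-]; rewrite mem_pblock.
    by rewrite (cover_partition partP) inE.
  rewrite (_ : [set u in _ | _] = set0) ?cards0 //; apply/setP => u; rewrite !inE.
  apply: contraNF nB => /eqP <-; apply: pblock_mem.
  by rewrite (cover_partition partP) inE.
rewrite real_ceil_le_int ?num_real // ler_pdivrMr ?ltr0n ?subn_gt0 //.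
by rewrite -pmulrn -natrM ler_nat subn1.
Qed.
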